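(* Let $T(k,n)$, for integers $n\ge1$ and $0\le k\le n$, denote the number of permutations $\alpha\in S_n$ with $H(\alpha\beta,\beta\alpha)=k$ where $\beta$ is an $n$-cycle in $S_n$. Then, as formal power series, \[ \sum_{n,k}T(k,n)\frac{z^n}{n!}u^k = z e^{z(1-u)}\Big(\big(1-\log(1-zu)\big)(1-u)+\frac{u}{1-zu}\Big). \]
   Context: $S_n$ is the symmetric group on $[n]$; $H(\sigma,\tau)=|\{a:\sigma(a)\ne\tau(a)\}|$ is the Hamming metric. $T(k,n)$ does not depend on the chosen $n$-cycle. *)

(* Defs.v *)
From HB Require Import structures.
From mathcomp Require Import all_boot all_algebra all_fingroup.
From mathcomp Require Import boolp.

Set Implicit Arguments.
Unset Strict Implicit.
Unset Printing Implicit Defensive.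

Import GRing.Theory.
Local Open Scope ring_scope.

(* [fps R] is R[[X]]. Series in several variables are obtained by iteration:
   [fps (fps R)] is R[[u]][[z]] = R[[z, u]]. *)
Record fps (R : Type) := Fps { coefs : nat -> R }.

HB.instance Definition _ (R : Type) := gen_eqMixin (fps R).
HB.instance Definition _ (R : Type) := gen_choiceMixin (fps R).

Lemma fpsP (R : Type) (f g : fps R) : f = g <-> coefs f =1 coefs g.
Proof.
by split=> [-> //|]; case: f g => f [g] /= /funext ->.
Qed.

Section Zmodule.
Variable R : zmodType.
Implicit Types f g h : fps R.

Definition fps_zero : fps R := Fps (fun=> 0).
Definition fps_opp f : fps R := Fps (fun n => - coefs f n).
Definition fps_add f g : fps R := Fps (fun n => coefs f n + coefs g n).

Fact fps_addA : associative fps_add.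
Proof. by move=> f g h; apply/fpsP => n /=; rewrite addrA. Qed.
Fact fps_addC : commutative fps_add.
Proof. by move=> f g; apply/fpsP => n /=; rewrite addrC. Qed.
Fact fps_add0 : left_id fps_zero fps_add.
Proof. by move=> f; apply/fpsP => n /=; rewrite add0r. Qed.
Fact fps_addN : left_inverse fps_zero fps_opp fps_add.
Proof. by move=> f; apply/fpsP => n /=; rewrite addNr. Qed.

HB.instance Definition _ := GRing.isZmodule.Build (fps R)
  fps_addA fps_addC fps_add0 fps_addN.

Lemma coefs0 n : coefs (0 : fps R) n = 0. Proof. by []. Qed.
Lemma coefsD f g n : coefs (f + g) n = coefs f n + coefs g n. Proof. by []. Qed.
Lemma coefsN f n : coefs (- f) n = - coefs f n. Proof. by []. Qed.
Lemma coefs_sum (I : Type) (r : seq I) (P : pred I) (F : I -> fps R) n :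
  coefs (\sum_(i <- r | P i) F i) n = \sum_(i <- r | P i) coefs (F i) n.
Proof. by elim/big_rec2: _ => //= i _ x _ <-. Qed.

End Zmodule.

Section Ring.
Variable R : comNzRingType.
Implicit Types (f g h : fps R) (c : R).

Definition fpsC c : fps R := Fps (fun n => if n == 0%N then c else 0).
Definition fpsX : fps R := Fps (fun n => (n == 1%N)%:R).

Definition fps_mul f g : fps R :=
  Fps (fun n => \sum_(i < n.+1) coefs f i * coefs g (n - i)%N).

Definition fps_trunc N f : {poly R} := \poly_(i < N) coefs f i.

Lemma coefs_mul_trunc N f g n : (n < N)%N ->
  coefs (fps_mul f g) n = (fps_trunc N f * fps_trunc N g)`_n.
Proof.
move=> ltnN; rewrite coefM; apply: eq_bigr => i _.
by rewrite !coef_poly (leq_ltn_trans (leq_subr i n)) // (leq_trans (ltn_ord i)).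
Qed.

Fact fps_mulC : commutative fps_mul.
Proof.
by move=> f g; apply/fpsP => n; rewrite !(@coefs_mul_trunc n.+1) // mulrC.
Qed.

Fact fps_mulA : associative fps_mul.
Proof.
have assocE f g h n : coefs (fps_mul f (fps_mul g h)) n =
    (fps_trunc n.+1 f * (fps_trunc n.+1 g * fps_trunc n.+1 h))`_n.
  rewrite coefM; apply: eq_bigr => i _.
  by rewrite (@coefs_mul_trunc n.+1) ?ltnS ?leq_subr // coef_poly ltn_ord.
move=> f g h; apply/fpsP => n.
rewrite [fps_mul (fps_mul f g) h]fps_mulC !assocE.
by rewrite [_ * (fps_trunc _ f * _)]mulrC mulrA.
Qed.

Fact fps_mulCl c f n : coefs (fps_mul (fpsC c) f) n = c * coefs f n.
Proof.
rewrite /= big_ord_recl /= subn0 big1 ?addr0 // => i _.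
by rewrite mul0r.
Qed.

Fact fps_mul1 : left_id (fpsC 1) fps_mul.
Proof. by move=> f; apply/fpsP => n; rewrite fps_mulCl mul1r. Qed.

Fact fps_mulDl : left_distributive fps_mul (@fps_add R).
Proof.
move=> f g h; apply/fpsP => n /=; rewrite -big_split.
by apply: eq_bigr => i _ /=; rewrite mulrDl.
Qed.

Fact fps_one_neq0 : fpsC 1 != 0.
Proof. by apply/eqP => /fpsP /(_ 0%N) /eqP; rewrite /= oner_eq0. Qed.

HB.instance Definition _ := GRing.Zmodule_isComNzRing.Build (fps R)
  fps_mulA fps_mulC fps_mul1 fps_mulDl fps_one_neq0.

Lemma coefs1 n : coefs (1 : fps R) n = (n == 0%N)%:R. Proof. by case: n. Qed.
Lemma coefsM f g n :
  coefs (f * g) n = \sum_(i < n.+1) coefs f i * coefs g (n - i)%N.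
Proof. by []. Qed.
Lemma coefsCM c f n : coefs (fpsC c * f) n = c * coefs f n.
Proof. exact: fps_mulCl. Qed.
Lemma coefs0M f g : coefs (f * g) 0%N = coefs f 0%N * coefs g 0%N.
Proof. by rewrite coefsM big_ord1. Qed.

Lemma coefs_exp_small f i n : coefs f 0%N = 0 -> (n < i)%N -> coefs (f ^+ i) n = 0.
Proof.
move=> f0; elim: i n => // i IHi n; rewrite ltnS => le_ni.
rewrite exprS coefsM big_ord_recl f0 mul0r add0r big1 // => j _.
rewrite lift0 IHi ?mulr0 //; apply: leq_trans le_ni.
by rewrite ltn_subrL (leq_ltn_trans _ (ltn_ord j)).
Qed.

(* The substitution sum_i a_i f^i, meaningful when f has zero constant term:
   only the terms with i <= n then contribute to the coefficient of X^n. *)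
Definition fps_comp (a : nat -> R) f : fps R :=
  Fps (fun n => \sum_(i < n.+1) a i * coefs (f ^+ i) n).

Lemma coefs_comp N (a : nat -> R) f n : coefs f 0%N = 0 -> (n < N)%N ->
  coefs (fps_comp a f) n = \sum_(i < N) a i * coefs (f ^+ i) n.
Proof.
move=> f0 ltnN; rewrite /= (big_ord_widen N (fun i => a i * coefs (f ^+ i) n)) //.
rewrite big_mkcond; apply: eq_bigr => i _.
by case: ltnP => // /coefs_exp_small ->; rewrite ?mulr0.
Qed.

Lemma fps_geomK f : coefs f 0%N = 0 -> fps_comp (fun=> 1) f * (1 - f) = 1.
Proof.
move=> f0; apply/fpsP => n; rewrite coefsM.
transitivity (coefs ((\sum_(i < n.+1) f ^+ i) * (1 - f)) n).
  rewrite coefsM; apply: eq_bigr => i _; congr (_ * _).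
  rewrite (@coefs_comp n.+1) // coefs_sum.
  by apply: eq_bigr => j _; rewrite mul1r.
rewrite mulrC -opprB mulNr -subrX1 opprB coefsD coefsN.
by rewrite (coefs_exp_small f0) ?subr0.
Qed.

End Ring.

Section UnitRing.
Variable R : comUnitRingType.
Implicit Types f g : fps R.

Definition fps_unit : {pred fps R} := fun f => coefs f 0%N \is a GRing.unit.

(* f = f_0 (1 - h) with h = 1 - f_0^-1 f, so that 1 / f = f_0^-1 sum_i h^i. *)
Definition fps_inv f : fps R :=
  if f \in fps_unit then
    fpsC (coefs f 0%N)^-1 * fps_comp (fun=> 1) (1 - fpsC (coefs f 0%N)^-1 * f)
  else f.

Fact fps_mulVx : {in fps_unit, left_inverse 1 fps_inv *%R}.
Proof.
move=> f uf; rewrite /fps_inv uf.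
set c := fpsC _; set h := 1 - c * f.
have h0 : coefs h 0%N = 0.
  by rewrite coefsD coefsN coefsCM coefs1 mulVr ?subrr.
by rewrite -(fps_geomK h0) mulrAC mulrC; congr (_ * _); rewrite /h subKr.
Qed.

Fact fps_unitPl f g : g * f = 1 -> fps_unit f.
Proof.
move/fpsP/(_ 0%N); rewrite coefs0M coefs1 => gf1.
by apply/unitrPr; exists (coefs g 0%N); rewrite mulrC.
Qed.

Fact fps_inv_out : {in [predC fps_unit], fps_inv =1 id}.
Proof. by move=> f /negPf nuf; rewrite /fps_inv nuf. Qed.

HB.instance Definition _ := GRing.ComNzRing_hasMulInverse.Build (fps R)
  fps_mulVx fps_unitPl fps_inv_out.

(* exp(f) = sum_i f^i / i!, for f with zero constant term, in a ring R where
   the positive integers are units (likewise for fps_log). *)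
Definition fps_exp f : fps R := fps_comp (fun i => (i`!)%:R^-1) f.

(* log(f) = sum_(i >= 1) (-1)^(i-1) (f - 1)^i / i, for f with constant term 1. *)
Definition fps_log f : fps R :=
  fps_comp (fun i => if i == 0%N then 0 else (-1) ^+ i.-1 / i%:R) (f - 1).

End UnitRing.

Definition hamming n (s t : 'S_n) : nat := #|[set a | s a != t a]|.

Definition is_ncycle n (s : 'S_n) : bool := porbits s == [set [set: 'I_n]].

(* The product of permutations is composed left to right here; this does not
   matter, as the Hamming distance is symmetric. *)
Definition num_k_commute k n (beta : 'S_n) : nat :=
  #|[set alpha : 'S_n | hamming (alpha * beta)%g (beta * alpha)%g == k]|.

Definition fps2_z : fps (fps rat) := fpsX _.
Definition fps2_u : fps (fps rat) := fpsC (fpsX _).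

(* The series sum_(n >= 1, 0 <= k <= n) (t k n / n!) z^n u^k. *)
Definition fps2_egf (t : nat -> nat -> nat) : fps (fps rat) :=
  Fps (fun n => Fps (fun k =>
    if (1 <= n)%N && (k <= n)%N then (t k n)%:R / (n`!)%:R else 0)).

(* Main.v *)
(** A point [x] satisfies [alpha (beta x) = beta (alpha x)] exactly when
    [beta ^ alpha^-1], an [n]-cycle, agrees with [beta] at [x].  Each [n]-cycle is
    obtained from [n] permutations [alpha], and those agreeing with [beta] on a set
    [S] of [m] points are the [beta * s] with [s] supported on the [n - m] points
    outside [beta(S)]; exactly [(n-m-1)!] of these [s] give an [n]-cycle ([1] if
    [m = n]), by induction on the support: adding a point [x] to it multiplies
    the count by the number of swaps [(x y)] that keep the old support meeting
    every cycle, and all but one do.  Hence, writing [1 = u + (1 - u)] at each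
    commuting point,
      [sum_k T(k,n) u^k / n! =
         n sum_m ((1-u)^m / m!) * (u^(n-m) (n-m-1)! / (n-m)!)],
    so the generating function is
    [z * d/dz (exp (z (1-u)) * (1 - log (1 - z u)))]. *)
Require Import Defs.
From mathcomp Require Import all_boot all_algebra all_fingroup.
From mathcomp Require Import ring.
Import GRing.Theory.
Local Open Scope ring_scope.

Set Implicit Arguments.
Unset Strict Implicit.
Unset Printing Implicit Defensive.

(** * Cycles of a permutation after multiplication by a swap *)

Section SingleCycle.
Variable T : finType.
Implicit Types (x y t : T) (b s c : {perm T}) (X : {set T}).

Definition single_cycle s : bool := [forall x, forall y, y \in porbit s x].

(** The induction invariant: for nonempty [X] it is exactly the condition under which some [s]
    supported on [X] makes [b * s] a single cycle. *)
Definition meets_cycles s X : bool :=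
  [forall t, exists y in X, y \in porbit s t].

Lemma single_cycleP s :
  reflect (forall x y, y \in porbit s x) (single_cycle s).
Proof. by apply: (iffP forallP) => [h x|h x]; [apply/forallP|apply/forallP]. Qed.

Lemma meets_cyclesP s X :
  reflect (forall t, exists2 y, y \in X & y \in porbit s t) (meets_cycles s X).
Proof. by apply: (iffP forallP) => h t; apply/exists_inP. Qed.

Lemma mem_porbit_trans s x y t :
  y \in porbit s x -> t \in porbit s y -> t \in porbit s x.
Proof. by rewrite -eq_porbit_mem => /eqP ->. Qed.

Lemma mem_porbit_iter s i x : iter i s x \in porbit s x.
Proof. by rewrite -permX mem_porbit. Qed.

(** The swap moves only [x] and [y], both in [x |: X], so it has no effect until the orbit enters
    that set. *)
Lemma iter_mul_tperm b x y X t i : y \in x |: X ->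
    (forall j, 0 < j <= i -> iter j b t \notin x |: X)%N ->
  iter i (b * tperm x y)%g t = iter i b t.
Proof.
move=> yX; elim: i => // i IHi h /=.
rewrite IHi => [|j /andP[j0 ji]]; last by apply: h; rewrite j0 ltnW.
have := h i.+1; rewrite leqnn => /(_ isT) /= nX.
by rewrite permM tpermD //; apply: contraNneq nX => <- //; rewrite setU11.
Qed.

Lemma tperm_mem x y X t : y \in x |: X -> t \in x |: X -> tperm x y t \in x |: X.
Proof. by move=> yX tX; case: tpermP => // _; rewrite setU11. Qed.

(* The swap removes [X] from a cycle exactly when [y] is the first return of
   [x] to [x |: X]: the arc from [x] up to [y] then closes up. *)
Lemma first_return b x X : x \notin X -> meets_cycles b (x |: X) ->
  exists2 w, w \in x |: X &
    {in x |: X, forall y, meets_cycles (b * tperm x y)%g X = (y != w)}.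
Proof.
move=> xX /meets_cyclesP bX.
have ret: exists k, iter k.+1 b x \in x |: X.
  exists #|porbit b x|.-1; rewrite prednK ?iter_porbit ?setU11 //.
  by rewrite lt0n card_porbit_neq0.
case: (ex_minnP ret) => k kX kmin.
have before_k j : (0 < j <= k)%N -> iter j b x \notin x |: X.
  case: j => // j /= jk; apply/negP => /kmin.
  by rewrite leqNgt jk.
exists (iter k.+1 b x) => // y yX.
have cx : iter k.+1 (b * tperm x y)%g x = tperm x y (iter k.+1 b x).
  by rewrite iterS (iter_mul_tperm yX before_k) permM.
have [eyw|nyw] := eqVneq y (iter k.+1 b x).
  apply/negP => /meets_cyclesP /(_ x) [t tX] /porbitP [i def_t].
  have per: iter k.+1 (b * tperm x y)%g x = x by rewrite cx -eyw tpermR.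
  (* The new cycle of [x] is the arc from [x] to [iter k b x], whose points other than [x] avoid
     [x |: X]. *)
  have : exists2 j, (j <= k)%N & t = iter j b x.
    rewrite {tX}def_t permX; elim: i => [|i [j jk IHi]]; first by exists 0%N.
    rewrite iterS IHi; move: jk; rewrite leq_eqVlt => /predU1P[->|jk].
      by exists 0%N => //; rewrite permM -iterS -eyw tpermR.
    exists j.+1 => //.
    have sub m : (m <= j.+1)%N -> forall l, (0 < l <= m)%N -> iter l b x \notin x |: X.
      move=> mj l /andP[l0 lm]; apply: before_k.
      by rewrite l0 (leq_trans lm) ?(leq_trans mj).
    by rewrite -(iter_mul_tperm yX (sub j (leqnSn j))) -iterS
               (iter_mul_tperm yX (sub _ (leqnn _))).
  case=> -[|j] jk tE; first by move: tX; rewrite tE (negPf xX).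
  by have := before_k j.+1 jk; rewrite -tE in_setU tX orbT.
(* The swap sends the first return to [x] only if that return is [y]; otherwise it lands in [X]. *)
have reachx : exists2 z, z \in X & z \in porbit (b * tperm x y)%g x.
  exists (tperm x y (iter k.+1 b x)); last by rewrite -cx mem_porbit_iter.
  have := tperm_mem yX kX; rewrite in_setU1 => /predU1P[|//].
  by move/(canRL (tpermK x y)); rewrite tpermL => /esym/eqP; rewrite (negPf nyw).
apply/meets_cyclesP => t.
(* The first hit of [x |: X] from [t] is merely swapped inside this set; if the result is [x],
   [reachx] carries on from there. *)
have reacht : exists2 z, z \in x |: X & z \in porbit (b * tperm x y)%g t.
  have hit: exists i, iter i b t \in x |: X.
    by have [z zX /porbitP[i zE]] := bX t; exists i; rewrite -permX -zE.
  case: (ex_minnP hit) => -[tX _|i iX imin]; first by exists t => //; apply: porbit_id.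
  have before_i j : (0 < j <= i)%N -> iter j b t \notin x |: X.
    by move=> /andP[_ ji]; apply/negP => /imin; rewrite leqNgt ltnS ji.
  exists (tperm x y (iter i.+1 b t)); first exact: tperm_mem.
  have <- : iter i.+1 (b * tperm x y)%g t = tperm x y (iter i.+1 b t).
    by rewrite iterS (iter_mul_tperm yX before_i) permM.
  exact: mem_porbit_iter.
case: reacht => z; rewrite in_setU1 => /predU1P[->|zX] tz; last by exists z.
by case: reachx => v vX xv; exists v => //; apply: mem_porbit_trans xv.
Qed.

(** On a cycle of [b] avoiding [X], [s] is the identity, so [b * s] stays on that cycle and never
    reaches [X]. *)
Lemma single_cycle_meets b s X : X != set0 -> perm_on X s ->
  single_cycle (b * s)%g -> meets_cycles b X.
Proof.
case/set0Pn=> x xX sX /single_cycleP cyc; apply/forallP => t.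
apply: contraT => /exists_inPn avoid.
have bE i : iter i (b * s)%g t = iter i b t.
  elim: i => // i IHi; rewrite iterS IHi permM (out_perm sX) //.
  by apply: contraTN (mem_porbit_iter b i.+1 t) => /avoid.
have [i xE] := porbitP _ _ _ (cyc t x).
by have := avoid x xX; rewrite xE permX bE mem_porbit_iter.
Qed.

(** * Counting the [s] of given support for which [b * s] is a single cycle *)

Lemma card_perm_on_setU1 x X (P : pred {perm T}) : x \notin X ->
  #|[set s | perm_on (x |: X) s && P s]| =
  \sum_(y in x |: X) #|[set s | perm_on X s && P (tperm x y * s)%g]|.
Proof.
move=> xX; rewrite -sum1dep_card.
(* With [y] the preimage of [x] under [s], dividing [s] on the left by [tperm x y] leaves a
   permutation fixing [x], hence supported on [X]. *)
rewrite (partition_big (fun s : {perm T} => s^-1%g x) (mem (x |: X))) /=; last first.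
  by move=> s /andP[sX _]; rewrite (perm_closed _ (perm_onV sX)) setU11.
apply: eq_bigr => y yX; rewrite -sum1dep_card.
rewrite (reindex_inj (mulgI (tperm x y))) /=; apply: eq_bigl => s.
rewrite andbAC; congr (_ && _).
have tX : perm_on (x |: X) (tperm x y).
  apply: subset_trans (tperm_on x y) _; apply/subsetP => z.
  by case/set2P => ->; rewrite ?setU11.
apply/andP/idP => [[sX /eqP sx]|sX].
  have {}sx : s x = x.
    move/(canRL (permKV _)): sx; by rewrite permM tpermR => <-.
  have {}sX : perm_on (x |: X) s.
    by rewrite -[s](mulKg (tperm x y)) tpermV perm_onM.
  apply/subsetP => z; rewrite inE => sz; have := subsetP sX z; rewrite !inE => /(_ sz).
  by case/predU1P => // zx; rewrite zx sx eqxx in sz.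
split; first by apply: perm_onM => //; apply: subset_trans sX _; apply: subsetUr.
by rewrite invMg tpermV permM (out_perm (perm_onV sX) xX) tpermL.
Qed.

Lemma card_perm_on_mul_single_cycle_S m b X : #|X| = m.+1 ->
  meets_cycles b X ->
  #|[set s | perm_on X s && single_cycle (b * s)%g]| = m`!.
Proof.
elim: m b X => [|m IHm] b X cardX bX.
  have [x defX] : exists x, X = [set x] by apply/cards1P/eqP.
  rewrite (_ : [set _ | _] = [set 1%g]) ?cards1 //; apply/setP => s; rewrite !inE.
  apply/andP/eqP => [[sX _]|->]; first by apply: perm_on_id sX _; rewrite cardX.
  split; [exact: perm_on1 | rewrite mulg1; apply/single_cycleP => y z].
  have reach t : t \in porbit b x.
    have [v] := meets_cyclesP _ _ bX t.
    by rewrite defX inE => /eqP ->; rewrite porbit_sym.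
  by apply: mem_porbit_trans (reach z); rewrite porbit_sym.
have [x xX] : exists x, x \in X by apply/card_gt0P; rewrite cardX.
have cardX' : #|X :\ x| = m.+1 by move: cardX; rewrite (cardsD1 x) xX => -[].
have X'0 : X :\ x != set0 by rewrite -card_gt0 cardX'.
have xX' : x \notin X :\ x by rewrite setD11.
rewrite -(setD1K xX) in bX *.
have [w wX wP] := first_return xX' bX.
rewrite card_perm_on_setU1 // (bigD1 w) //=.
rewrite (_ : #|_| = 0%N); last first.
  apply/eqP; rewrite cards_eq0 -subset0; apply/subsetP => s; rewrite !inE.
  case/andP => sX'; rewrite mulgA => /(single_cycle_meets X'0 sX').
  by rewrite wP ?eqxx.
rewrite add0r (eq_bigr (fun=> m`!)) => [|y /andP[yX yw]]; last first.
  rewrite -(IHm _ _ cardX' (_ : meets_cycles (b * tperm x y)%g _)) ?wP //.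
  by apply: eq_card => s; rewrite !inE mulgA.
rewrite (eq_bigl (mem ((x |: X :\ x) :\ w))) => [|y]; last by rewrite !inE andbC.
rewrite sum_nat_const factS; congr (_ * _)%N.
by have := cardsD1 w (x |: X :\ x); rewrite wX setD1K // cardX => -[].
Qed.

Lemma card_perm_on_mul_single_cycle b X : single_cycle b ->
  #|[set s | perm_on X s && single_cycle (b * s)%g]| = (#|X|.-1)`!.
Proof.
move=> cyc; have [->|X0] := eqVneq X set0.
  (* For empty [X] only [s = 1] counts, in agreement with the truncated [0.-1]. *)
  rewrite cards0 (_ : [set _ | _] = [set 1%g]) ?cards1 //; apply/setP => s.
  rewrite !inE; apply/andP/eqP => [[sX _]|->]; last by rewrite mulg1 perm_on1.
  by apply: perm_on_id sX _; rewrite cards0.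
apply: card_perm_on_mul_single_cycle_S.
  by rewrite prednK // card_gt0.
have /set0Pn[x xX] := X0.
by apply/meets_cyclesP => t; exists x => //; apply/single_cycleP.
Qed.

(** The case where [X] is the whole type, since [s] to [b * s] is a bijection. *)
Lemma card_single_cycle b : single_cycle b ->
  #|[set s | single_cycle s]| = (#|T|.-1)`!.
Proof.
move=> cyc; rewrite -cardsT -(card_perm_on_mul_single_cycle _ cyc).
rewrite -(card_preimset _ (mulgI b)); apply: eq_card => s; rewrite !inE.
by rewrite [perm_on _ _](_ : _ = true) //; apply/subsetP => x; rewrite inE.
Qed.

(** * Conjugators, and permutations commuting with [b] on a given set *)

Lemma single_cycleJ b a : single_cycle (b ^ a)%g = single_cycle b.
Proof.
suff imp c d : single_cycle c -> single_cycle (c ^ d)%g.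
  by apply/idP/idP => [/imp-/(_ a^-1%g)|/imp//]; rewrite conjgK.
move=> /single_cycleP cyc; apply/single_cycleP => x y.
have [i yE] := porbitP _ _ _ (cyc (d^-1%g x) (d^-1%g y)).
apply/porbitP; exists i.
by rewrite -conjXg -[in RHS](permKV d x) permJ -yE permKV.
Qed.

(** A conjugator [a] is determined by [a x], because it sends the [i]-th iterate of [x] under [b] to
    the [i]-th iterate of [a x] under [g]. *)
Lemma leq_card_conjugators b g : single_cycle b ->
  (0 < #|T|)%N -> (#|[set a | (b ^ a)%g == g]| <= #|T|)%N.
Proof.
move=> /single_cycleP cyc /card_gt0P[x _].
rewrite -(card_in_imset (f := fun a : {perm T} => a x)) ?max_card //.
move=> a1 a2; rewrite !inE => /eqP e1 /eqP e2 ax; apply/permP => y.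
have [i ->] := porbitP _ _ _ (cyc x y).
by rewrite -(permJ (b ^+ i) a1) -(permJ (b ^+ i) a2) !conjXg e1 e2 ax.
Qed.

(* [a |-> b ^ a] maps the [n!] permutations to the [(n-1)!] [n]-cycles with fibers
   of size at most [n], so all fibers have size exactly [n]. *)
Lemma card_conjugators b g : (0 < #|T|)%N -> single_cycle b -> single_cycle g ->
  #|[set a | (b ^ a)%g == g]| = #|T|.
Proof.
move=> T0 cb cg.
have le_n c : single_cycle c ->
    (#|[set a | (b ^ a)%g == c]| <= #|T|
       ?= iff (#|[set a | (b ^ a)%g == c]| == #|T|))%N.
  by move=> _; split=> //; apply: leq_card_conjugators.
have [_] := leqif_sum le_n.
have -> : \sum_(c | single_cycle c) #|[set a | (b ^ a)%g == c]| = (#|T|)`!.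
  transitivity #|{perm T}|; last first.
    rewrite -cardsT -card_perm; apply: eq_card => s.
    by rewrite inE; apply/esym/subsetP => x; rewrite inE.
  rewrite -[RHS]sum1_card.
  rewrite [RHS](partition_big (fun a : {perm T} => (b ^ a)%g) single_cycle) /=.
    by apply: eq_bigr => c _; rewrite -sum1dep_card.
  by move=> a _; rewrite single_cycleJ.
rewrite sum_nat_const -(prednK T0) factS prednK // mulnC.
by rewrite -cardsE (card_single_cycle cb) eqxx => /esym/forall_inP/(_ g cg)/eqP.
Qed.

Lemma card_commuting_on b (S : {set T}) : (0 < #|T|)%N -> single_cycle b ->
  #|[set a : {perm T} | [forall x in S, b (a x) == a (b x)]]| =
  (#|T| * ((#|T| - #|S|).-1)`!)%N.
Proof.
move=> T0 cb.
pose A := [set g : {perm T} | single_cycle g && [forall x in S, g x == b x]].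
have goodE (a : {perm T}) x : (b (a x) == a (b x)) = ((b ^ a^-1)%g x == b x).
  have -> : (b ^ a^-1)%g x = a^-1%g (b (a x)) by rewrite -permJ permK.
  by rewrite [RHS](can2_eq (permKV a) (permK a)).
rewrite -sum1dep_card.
rewrite (partition_big (fun a : {perm T} => (b ^ a^-1)%g) (mem A)) /=; last first.
  move=> a /forall_inP h; rewrite inE single_cycleJ cb.
  by apply/forall_inP => x xS; rewrite -goodE h.
rewrite (eq_bigr (fun=> #|T|)) => [|g]; last first.
  rewrite inE => /andP[cg /forall_inP gS]; rewrite sum1dep_card.
  rewrite -(card_conjugators T0 cg cb); apply: eq_card => a; rewrite !inE.
  have -> : ((g ^ a)%g == b) = ((b ^ a^-1)%g == g).
    by rewrite (can2_eq (conjgK a) (conjgKV a)) eq_sym.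
  rewrite andbC; case: eqP => //= def_g; apply/forall_inP => x xS.
  by rewrite goodE def_g gS.
rewrite sum_nat_const mulnC; congr (_ * _)%N.
(* Writing [g = b * s], agreement with [b] on [S] says that [s] fixes [b @: S] pointwise. *)
rewrite -(card_preimset A (mulgI b)).
have -> : (#|T| - #|S|)%N = #|~: (b @: S)|.
  by rewrite [RHS]cardsCs setCK card_imset //; apply: perm_inj.
rewrite -(card_perm_on_mul_single_cycle _ cb); apply: eq_card => s; rewrite !inE.
rewrite andbC; congr (_ && _); apply/forall_inP/subsetP => h x.
  rewrite inE => sx; rewrite inE; apply: contraNN sx => /imsetP[y yS ->].
  by rewrite -permM h.
move=> xS; rewrite permM; have := h (b x); rewrite !inE imset_f //.
by case: eqP => // _ /(_ isT).
Qed.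

End SingleCycle.

(** * Substitution of [z * c] into a series, and the formal derivative *)

Section Series.
Variable R : comNzRingType.
Implicit Types (f g : fps R) (c : R).

Lemma coefsXM f n : coefs (fpsX R * f) n = if n is n'.+1 then coefs f n' else 0.
Proof.
case: n => [|n]; first by rewrite coefs0M mul0r.
rewrite coefsM big_ord_recl mul0r add0r big_ord_recl mul1r big1 ?addr0.
  by rewrite subn1.
by move=> i _; rewrite mul0r.
Qed.

Lemma fpsCB : {morph @fpsC R : c d / c - d}.
Proof. by move=> c d; apply/fpsP => -[|n] //=; rewrite subr0. Qed.

Lemma coefs_XC_exp c i n :
  coefs ((fpsX R * fpsC c) ^+ i) n = if n == i then c ^+ i else 0.
Proof.
elim: i n => [|i IHi] n; first by rewrite expr0 coefs1; case: eqP.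
rewrite exprS -mulrA coefsXM; case: n => [|n] //.
by rewrite coefsCM IHi exprS eqSS; case: eqP; rewrite ?mulr0.
Qed.

Lemma coefs_comp_XC (a : nat -> R) c n :
  coefs (fps_comp a (fpsX R * fpsC c)) n = a n * c ^+ n.
Proof.
rewrite /= (bigD1 ord_max) //= coefs_XC_exp eqxx big1 ?addr0 // => i ne.
rewrite coefs_XC_exp ifN ?mulr0 // eq_sym.
by apply: contraNneq ne => e; apply/eqP/val_inj.
Qed.

Definition fps_deriv f : fps R := Fps (fun n => coefs f n.+1 *+ n.+1).

Lemma coefs_deriv f n : coefs (fps_deriv f) n = coefs f n.+1 *+ n.+1.
Proof. by []. Qed.

Lemma fps_derivM f g : fps_deriv (f * g) = fps_deriv f * g + f * fps_deriv g.
Proof.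
apply/fpsP => n; rewrite coefsD !coefsM /= -sumrMnl.
(* The factor [n.+1] splits as [i + (n.+1 - i)]; the first part vanishes at [i = 0], the second at
   [i = n.+1]. *)
have split_n (i : 'I_n.+2) : coefs f i * coefs g (n.+1 - i) *+ n.+1 =
    (coefs f i *+ i) * coefs g (n.+1 - i) +
    coefs f i * (coefs g (n.+1 - i) *+ (n.+1 - i)).
  by rewrite mulrnAl mulrnAr -mulrnDr subnKC // -ltnS.
rewrite (eq_bigr _ (fun i _ => split_n i)) big_split /=; congr (_ + _).
  rewrite big_ord_recl mulr0n mul0r add0r.
  by apply: eq_bigr => i _; rewrite lift0 subSS.
rewrite big_ord_recr /= subnn mulr0n mulr0 addr0; apply: eq_bigr => i _.
by rewrite subSn // -ltnS.
Qed.

End Series.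

(** * Coefficients and derivatives of the exponential and logarithmic factors *)

Section ExpLog.
Variable R : comUnitRingType.
Hypothesis nat_unit : forall n, n.+1%:R \is a @GRing.unit R.
Implicit Type c : R.
Local Notation z := (fpsX R).

Lemma fact_unit n : n`!%:R \is a @GRing.unit R.
Proof. by rewrite -(prednK (fact_gt0 n)). Qed.

Lemma coefs_exp_XC c n : coefs (fps_exp (z * fpsC c)) n = n`!%:R^-1 * c ^+ n.
Proof. exact: coefs_comp_XC. Qed.

(** The quotient of factorials is 1 at [n = 0] and [1/n] afterwards, so the summand 1 fits the same
    formula; this is the shape of the count of single cycles. *)
Lemma coefs_sub_log c n :
  coefs (1 - fps_log (1 - z * fpsC c)) n = (n.-1)`!%:R / n`!%:R * c ^+ n.
Proof.
have -> : fps_log (1 - z * fpsC c) =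
    fps_comp (fun i => if i == 0%N then 0 else (-1) ^+ i.-1 / i%:R) (z * fpsC (- c)).
  rewrite /fps_log addrAC subrr add0r -mulrN; congr (fps_comp _ (_ * _)).
  by rewrite -[- c]sub0r fpsCB; apply/fpsP => -[|m]; rewrite /= ?add0r ?addr0.
rewrite coefsD coefsN coefs_comp_XC coefs1.
case: n => [|n] /=; first by rewrite mul0r subr0 mulr1 divr1.
have -> : n`!%:R / n.+1`!%:R = n.+1%:R^-1 :> R.
  by rewrite factS natrM invrM ?fact_unit // mulrA divrr ?fact_unit // mul1r.
rewrite sub0r [(- c) ^+ _]exprNn exprS mulN1r mulNr mulrN opprK mulrACA.
by rewrite -expr2 sqrr_sign mul1r.
Qed.

Lemma fps_deriv_exp_XC c :
  fps_deriv (fps_exp (z * fpsC c)) = fpsC c * fps_exp (z * fpsC c).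
Proof.
apply/fpsP => n; rewrite coefsCM coefs_deriv !coefs_exp_XC mulrCA -exprS.
rewrite -mulrnAl; congr (_ * _); rewrite factS natrM invrM ?fact_unit //.
by rewrite -mulr_natr -mulrA mulVr ?mulr1.
Qed.

Lemma fps_deriv_sub_log c :
  fps_deriv (1 - fps_log (1 - z * fpsC c)) = fpsC c / (1 - z * fpsC c).
Proof.
have zc0 : coefs (z * fpsC c) 0%N = 0 by rewrite coefs0M mul0r.
have geom : (1 - z * fpsC c)^-1 = fps_comp (fun=> 1) (z * fpsC c).
  have U : 1 - z * fpsC c \is a GRing.unit.
    by apply/unitrPr; exists (fps_comp (fun=> 1) (z * fpsC c)); rewrite mulrC fps_geomK.
  by apply: (mulIr U); rewrite mulVr // fps_geomK.
apply/fpsP => n; rewrite geom coefsCM coefs_comp_XC mul1r -exprS.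
rewrite coefs_deriv coefs_sub_log -mulrnAl factS natrM invrM ?fact_unit //.
by rewrite mulrA divrr ?fact_unit // mul1r -mulr_natr mulVr ?mul1r.
Qed.

End ExpLog.

(** * The Hamming distance enumerator over ['S_n] *)

Lemma is_ncycle_single_cycle n (s : 'S_n) : is_ncycle s -> single_cycle s.
Proof.
move=> /eqP cyc; apply/single_cycleP => x y.
have : porbit s x \in porbits s by apply: imset_f.
by rewrite cyc inE => /eqP ->.
Qed.

(* Writing each factor [u] (non-commuting point) or [1] (commuting point) of
   [u ^+ hamming] as [u] plus [0] or [1 - u] turns the sum into one over sets of
   points where commutation is imposed. *)
Lemma sum_exp_hamming (R : comNzRingType) (u : R) n (b : 'S_n) :
    (0 < n)%N -> single_cycle b ->
  \sum_(a : 'S_n) u ^+ hamming (a * b)%g (b * a)%g =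
  \sum_(m < n.+1) ('C(n, m) * (n * (n - m).-1`!))%:R * ((1 - u) ^+ m * u ^+ (n - m)).
Proof.
move=> n0 cb.
pose good (a : 'S_n) (i : 'I_n) := b (a i) == a (b i).
pose w (m : nat) := (1 - u) ^+ m * u ^+ (n - m).
have expand a : u ^+ hamming (a * b)%g (b * a)%g =
    \sum_(J : {set 'I_n}) if [forall i in J, good a i] then w #|J| else 0.
  transitivity (\prod_i ((if good a i then 1 - u else 0) + u)).
    rewrite /hamming -prodr_const big_mkcond; apply: eq_bigr => i _.
    by rewrite inE !permM -/(good a i); case: (good a i); rewrite ?subrK ?add0r.
  rewrite bigA_distr; apply: eq_bigr => J _.
  case: forall_inP => [goodJ|/forall_inP].
    rewrite (bigID (mem J)) /=; congr (_ * _).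
      by rewrite -prodr_const; apply: eq_bigr => i iJ; rewrite iJ goodJ.
    rewrite -[n in (n - _)%N]card_ord -(cardsC J) addKn -prodr_const.
    by apply: eq_big => [i|i /negPf ->]; rewrite ?inE.
  rewrite negb_forall_in => /exists_inP[i iJ /negPf bad].
  by rewrite (bigD1 i) //= iJ bad mul0r.
rewrite (eq_bigr _ (fun a _ => expand a)) exchange_big /=.
have count (J : {set 'I_n}) :
    \sum_(a : 'S_n) (if [forall i in J, good a i] then w #|J| else 0) =
    (n * (n - #|J|).-1`!)%:R * w #|J|.
  rewrite -big_mkcond sumr_const mulr_natl; congr (_ *+ _).
  have := card_commuting_on J _ cb; rewrite card_ord => <- //.
  by rewrite cardsE.
rewrite (eq_bigr _ (fun J _ => count J)).
have leJ (J : {set 'I_n}) : (#|J| < n.+1)%N by rewrite ltnS -[leqRHS]card_ord max_card.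
(* The summand depends only on [#|J|]; grouping by it produces the binomial coefficient. *)
rewrite (partition_big (fun J => Ordinal (leJ J)) predT) //=; apply: eq_bigr => m _.
rewrite (eq_bigr (fun=> (n * (n - m).-1`!)%:R * w m)) => [|J /eqP <- //].
rewrite sumr_const [in RHS]natrM -mulrA [RHS]mulr_natl; congr (_ *+ _).
have := card_draws 'I_n m; rewrite card_ord => <-; apply: eq_card => J.
by rewrite !inE.
Qed.

(** * Comparison of the coefficients of [z] powers *)

Lemma fps_rat_nat_unit n : n.+1%:R \is a @GRing.unit (fps rat).
Proof.
suff cn m : coefs (m%:R : fps rat) 0%N = m%:R.
  have -> : (n.+1%:R \is a @GRing.unit (fps rat)) =
    (coefs (n.+1%:R : fps rat) 0%N \is a GRing.unit) by [].
  by rewrite cn unitfE Num.Theory.pnatr_eq0.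
by elim: m => // m IHm; rewrite !mulrS coefsD IHm.
Qed.

Lemma coefs_natM (R : comNzRingType) m (f : fps R) k :
  coefs (m%:R * f) k = m%:R * coefs f k.
Proof.
rewrite !mulr_natl; elim: m => // m IHm.
by rewrite !mulrS coefsD IHm.
Qed.

Lemma coefs_Xn (R : comNzRingType) i n : coefs (fpsX R ^+ i) n = (i == n)%:R.
Proof.
elim: i n => [|i IHi] [|n] //; first by rewrite exprS coefsXM.
by rewrite exprS coefsXM IHi.
Qed.

Lemma coefs_fps2_egf n (b : 'S_n) (t : nat -> nat -> nat) : (0 < n)%N ->
    (forall k, t k n = num_k_commute k b) ->
  n`!%:R * coefs (fps2_egf t) n =
  \sum_(a : 'S_n) fpsX rat ^+ hamming (a * b)%g (b * a)%g.
Proof.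
move=> n0 tE; apply/fpsP => k; rewrite coefs_natM coefs_sum.
rewrite (eq_bigr _ (fun a _ => coefs_Xn _ _ _)) -natr_sum -big_mkcond /= n0.
rewrite tE /num_k_commute sum1dep_card.
case: leqP => [_|nk].
  by rewrite mulrC divfK // Num.Theory.pnatr_eq0 -lt0n fact_gt0.
(* The cutoff [k <= n] loses nothing: a Hamming distance on [n] points is at most [n]. *)
rewrite mulr0 (_ : #|_| = 0%N) //; apply/eqP; rewrite cards_eq0 -subset0.
apply/subsetP => a; rewrite inE => /eqP hk.
have := max_card (mem [set i | (a * b)%g i != (b * a)%g i]).
by rewrite -/(hamming _ _) hk card_ord leqNgt nk.
Qed.

Theorem theorem4 (beta : forall n : nat, {perm 'I_n})
    (beta_cycle : forall n : nat, (1 <= n)%N -> is_ncycle (beta n)) :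
  let z := fps2_z in
  let u := fps2_u in
  fps2_egf (fun k n => num_k_commute k (beta n)) =
  z * fps_exp (z * (1 - u)) *
    ((1 - fps_log (1 - z * u)) * (1 - u) + u / (1 - z * u)).
Proof.
move=> z u; pose x := fpsX rat.
have natU := fps_rat_nat_unit.
have -> : 1 - u = fpsC (1 - x) by rewrite fpsCB.
pose E := fps_exp (z * fpsC (1 - x)); pose L := 1 - fps_log (1 - z * u).
(* Leibniz rule: [E] has derivative [(1 - u) * E] and [L] has derivative [u / (1 - z * u)]. *)
have -> : z * E * (L * fpsC (1 - x) + u / (1 - z * u)) = z * fps_deriv (E * L).
  rewrite fps_derivM fps_deriv_exp_XC // fps_deriv_sub_log // -mulrA; congr (_ * _).
  by rewrite [L * _]mulrC [E * (_ + _)]mulrDr !mulrA [E * fpsC (1 - x)]mulrC.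
apply/fpsP => -[|n]; first by apply/fpsP => k; rewrite coefsXM.
apply: (mulrI (fact_unit natU n.+1)).
rewrite (coefs_fps2_egf (b := beta n.+1)) // sum_exp_hamming //; last first.
  exact/is_ncycle_single_cycle/beta_cycle.
rewrite coefsXM coefs_deriv coefsM -sumrMnl mulr_sumr.
apply: eq_bigr => m _; rewrite coefs_exp_XC coefs_sub_log //.
set N := n.+1; have le_mN : (m <= N)%N by rewrite -ltnS.
rewrite -(bin_fact le_mN) !(natrM _ 'C(N, m)) (natrM _ N) (natrM _ m`!).
(* The sums agree term by term: [c] and [d] stand for the factorials of [m] and [N - m], and the [N]
   conjugators match the factor [M] from the derivative. *)
have cancel M (C p c d A B : fps rat) : c \is a GRing.unit -> d \is a GRing.unit ->
    C * (M%:R * p) * (A * B) = C * (c * d) * (c^-1 * A * (p / d * B) *+ M).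
  move=> Uc Ud; rewrite -[in RHS]mulr_natr.
  transitivity ((c / c) * (d / d) * (C * (M%:R * p) * (A * B))).
    by rewrite !divrr // !mul1r.
  (* Once the inverses are generalized, the identity is polynomial. *)
  by move: c^-1 d^-1 => c' d'; ring.
by apply: cancel; apply: fact_unit.
Qed.
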